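(* Let $\mathcal X$ be a Hilbert space and let $V\in\mathcal C^0(0,T;\mathcal X)$ be such that $V_{|I_n}\in\mathbb P_{p_n^t}(I_n;\mathcal X)$ for all $n=1,\dots,N$, with a given element $(V^-)'(0,\cdot)\in\mathcal X$. Then the reconstruction $\widehat V$ of $V$ (defined in the context), which is a piecewise polynomial in time over the grid, is globally of class $\mathcal C^1$ in time, i.e. $\widehat V\in\mathcal C^1(0,T;\mathcal X)$.
   Context: Time grid: $0=t_0<t_1<\dots<t_N=T$, $I_n:=(t_{n-1},t_n]$, $\tau_n:=t_n-t_{n-1}$, with polynomial degrees $p_n^t\ge2$. $\mathbb P_q(I_n;\mathcal X)$ is the space of $\mathcal X$-valued polynomials in time of degree at most $q$ on $I_n$; primes are time derivatives. For $n\ge2$, $(V^-)'(t_{n-1},\cdot):=V'{}_{|I_{n-1}}(t_{n-1},\cdot)$; $(V^+)'(t_{n-1},\cdot):=V'{}_{|I_n}(t_{n-1},\cdot)$; $[\![V']\!](t_{n-1},\cdot):=(V^+)'(t_{n-1},\cdot)-(V^-)'(t_{n-1},\cdot)$ for $n=1,\dots,N$ (for $n=1$ with the given element $(V^-)'(0,\cdot)$). Reconstruction: $\widehat V$ is defined piecewise; for each $n$, $\widehat V_{|I_n}\in\mathbb P_{p_n^t+1}(I_n;\mathcal X)$ satisfies $$(\widehat V'',q)_{L^2(I_n;\mathcal X)}=(V'',q)_{L^2(I_n;\mathcal X)}+([\![V']\!](t_{n-1},\cdot),q(t_{n-1},\cdot))_{\mathcal X}\quad\forall q\in\mathbb P_{p_n^t-1}(I_n;\mathcal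 X),$$ $$\widehat V(t_{n-1},\cdot)=V(t_{n-1},\cdot),\qquad\widehat V'(t_{n-1},\cdot)=(V^-)'(t_{n-1},\cdot)\quad\text{in }\mathcal X,$$ where the point values of $\widehat V$ and $\widehat V'$ at $t_{n-1}$ are those of the polynomial on $I_n$. *)

(* Defs.v *)
From mathcomp Require Import all_boot all_order all_algebra.
From mathcomp Require Import all_classical all_reals all_analysis.

Set Implicit Arguments.
Unset Strict Implicit.
Unset Printing Implicit Defensive.

Import Order.TTheory GRing.Theory Num.Theory.
Import numFieldNormedType.Exports.

Local Open Scope classical_set_scope.
Local Open Scope ring_scope.

(** Real Hilbert spaces: a complete normed module [X] over [R] whose norm is
    the one induced by the symmetric positive definite bilinear form [dot]. *)
Definition hilbert_norm (R : realType) (X : completeNormedModType R)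
    (dot : {dot X for (@idfun R)}) : Prop :=
  forall x : X, dot x x = `|x| ^+ 2.

Definition time_grid (R : realType) (N : nat) (T : R) (t : nat -> R) : Prop :=
  [/\ t 0%N = 0, t N = T & forall n, (n < N)%N -> t n < t n.+1].

(** [cell t n] is I_n = (t_{n-1}, t_n]; it is used for 1 <= n <= N. *)
Definition cell (R : realType) (t : nat -> R) (n : nat) : set R :=
  `]t n.-1, t n]%classic.

Definition poly_in_time (R : realType) (X : normedModType R) (q : nat)
    (f : R -> X) : Prop :=
  exists c : 'I_q.+1 -> X, forall s, f s = \sum_(k < q.+1) s ^+ k *: c k.

(** A function whose restriction to each I_n is a polynomial of degree at most
    [deg n]; [P n] is that polynomial, extended to the whole real line (it is
    determined by [V] because I_n is infinite).  Values and time derivatives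
    of [V] restricted to I_n, at t_{n-1} in particular, are those of [P n]. *)
Definition piecewise_poly (R : realType) (X : normedModType R) (N : nat)
    (t : nat -> R) (deg : nat -> nat) (V : R -> X) (P : nat -> R -> X) : Prop :=
  forall n, (1 <= n <= N)%N ->
    poly_in_time (deg n) (P n) /\ {in cell t n, V =1 P n}.

(** (V^-)'(t_{n-1}); for n = 1 this is the given element [v0]. *)
Definition left_derivative (R : realType) (X : normedModType R) (t : nat -> R)
    (v0 : X) (P : nat -> R -> X) (n : nat) : X :=
  if n is m.+2 then derive1 (P m.+1) (t m.+1) else v0.

Definition right_derivative (R : realType) (X : normedModType R) (t : nat -> R)
    (P : nat -> R -> X) (n : nat) : X :=
  derive1 (P n) (t n.-1).

Definition derivative_jump (R : realType) (X : normedModType R) (t : nat -> R)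
    (v0 : X) (P : nat -> R -> X) (n : nat) : X :=
  right_derivative t P n - left_derivative t v0 P n.

Definition L2_inner (R : realType) (X : completeNormedModType R)
    (dot : {dot X for (@idfun R)}) (I : set R) (f g : R -> X) : R :=
  (\int[lebesgue_measure]_(s in I) dot (f s) (g s))%R.

(** [Vh], with pieces [Q], is a reconstruction of [V], with pieces [P].  No
    compatibility of [Q n] and [Q n.+1] at t_n is assumed.  The cells do not
    cover t_0, where [Vh] takes the value of its first piece. *)
Definition reconstruction (R : realType) (X : completeNormedModType R)
    (dot : {dot X for (@idfun R)}) (N : nat) (t : nat -> R) (p : nat -> nat)
    (v0 : X) (V : R -> X) (P : nat -> R -> X)
    (Vh : R -> X) (Q : nat -> R -> X) : Prop :=
  [/\ piecewise_poly N t (fun n => (p n).+1) Vh Q,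
      Vh (t 0%N) = Q 1%N (t 0%N) &
      forall n, (1 <= n <= N)%N ->
        [/\ forall q : R -> X, poly_in_time (p n).-1 q ->
              L2_inner dot (cell t n) (derive1n 2 (Q n)) q =
              L2_inner dot (cell t n) (derive1n 2 (P n)) q
                + dot (derivative_jump t v0 P n) (q (t n.-1)),
            Q n (t n.-1) = V (t n.-1) &
            derive1 (Q n) (t n.-1) = left_derivative t v0 P n]].

(** Class C^1 on the closed interval [a, b], with one-sided difference
    quotients at the end points. *)
Definition C1_on (R : realType) (X : normedModType R) (a b : R)
    (f : R -> X) : Prop :=
  exists2 f' : R -> X,
    {within `[a, b], continuous f'} &
    forall x, x \in `[a, b] ->
      (y - x)^-1 *: (f y - f x) @[y --> within `[a, b] (x^')] --> f' x.

(* Main.v *)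
Require Import Defs.
From mathcomp Require Import all_boot all_order all_algebra.
From mathcomp Require Import all_classical all_reals all_analysis.
From mathcomp Require Import ring lra.

Import Order.TTheory GRing.Theory Num.Theory.
Import numFieldNormedType.Exports.

Local Open Scope classical_set_scope.
Local Open Scope ring_scope.

(** On one cell $(a, b]$ let $D$ be the difference of the reconstruction and of
    the function to be reconstructed, and $j$ the jump of the derivative at $a$.
    The initial conditions say $D(a) = 0$ and $D'(a) = -j$, the first one because
    the reconstructed function is continuous; the variational identity says
    $\int_a^b (D'', q) = (j, q(a))$.  As the degree is at least 2, affine
    functions $q$ may be used as tests.  Integrating by parts, a constant
    $q = x$ gives $(D'(b) - D'(a), x) = (j, x)$, hence $D'(b) = 0$; then
    $q(s) = s x$ gives $(D(b), x) = 0$, hence $D(b) = 0$.  This is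
    [reconstruction_cell].

    So the piece of the reconstruction on each cell ends with the value and the
    slope of the original function there, and these are the initial value and
    the initial slope prescribed for the next piece.  Pieces that are smooth on
    the whole line and agree to first order at a node glue to a function of
    class $C^1$ ([is_derive_glue], [continuous_glue]); an induction over the
    cells produces a $C^1$ function on the line that agrees with the
    reconstruction on $[0, T]$.

    The integrals are computed on real polynomials.  A polynomial in time is
    written as a combination $\sum_k p_k(s) c_k$ of fixed vectors with real
    polynomials as coefficients ([poly_comb]), and its inner product with a
    fixed vector is then a real polynomial. *)

Set Implicit Arguments.
Unset Strict Implicit.

(** * Difference quotients and gluing of differentiable functions *)

Lemma dnbhs_shift (R : realType) (x : R) :
  (fun y => y - x) @ x^' = (0 : R)^' :> set_system R.
Proof.
have E (A : set R) : (\forall y \near x, y != x -> A (y - x)) =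
    (\forall h \near 0, h != 0 -> A h).
  rewrite [RHS](near_shift x) /= sub0r.
  by congr (nbhs x _); apply/funext => y /=; rewrite subr_eq0.
apply/funext => A; exact: E.
Qed.

(** Quotients indexed by the moving point, rather than by the increment, can be
    restricted to an interval or split at a node. *)
Lemma is_derive1P (R : realType) (X : normedModType R) (f : R -> X) (x : R)
    (l : X) :
  is_derive x 1 f l <-> (y - x)^-1 *: (f y - f x) @[y --> x^'] --> l.
Proof.
have E : (fun h => h^-1 *: ((f \o shift x) (h *: 1) - f x)) @ 0^' =
    ((y - x)^-1 *: (f y - f x) @[y --> x^']).
  rewrite -(dnbhs_shift x) -fmap_comp.
  apply: (f_equal (fun g => fmap g x^')); apply/funext => y /=.
  by rewrite [_%:A]mulr1 subrK.
split.
- by move=> [df fl]; rewrite -E -fl; exact: df.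
- rewrite -E => H; apply: DeriveDef.
  + by apply/cvg_ex; exists l.
  + exact/cvg_lim.
Qed.

Lemma cvg_if (R : realType) (X : normedModType R) (T : Type)
    (F : set_system T) (FF : Filter F) (b : T -> bool) (f g : T -> X) (l : X) :
  f @ F --> l -> g @ F --> l -> (if b y then f y else g y) @[y --> F] --> l.
Proof.
move=> /cvgrPdist_lt fl /cvgrPdist_lt gl; apply/cvgrPdist_lt => e e0.
near=> y; case: (b y); near: y; [exact: fl|exact: gl].
Unshelve. all: by end_near. Qed.

Definition glue (R : realType) (X : Type) (c : R) (f g : R -> X) : R -> X :=
  fun s => if s <= c then f s else g s.

Lemma glue_near_left (R : realType) (X : Type) (c x : R) (f g : R -> X) :
  x < c -> \forall y \near x, f y = glue c f g y.
Proof.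
move=> xc; near=> y; rewrite /glue ifT//.
by apply/ltW; near: y; exact: lt_nbhsl.
Unshelve. all: by end_near. Qed.

Lemma glue_near_right (R : realType) (X : Type) (c x : R) (f g : R -> X) :
  c < x -> \forall y \near x, g y = glue c f g y.
Proof.
move=> cx; near=> y; rewrite /glue ifF//; apply/negbTE; rewrite -ltNge.
by near: y; exact: lt_nbhsr.
Unshelve. all: by end_near. Qed.

Lemma continuous_glue (R : realType) (X : normedModType R) (c : R)
    (f g : R -> X) : continuous f -> continuous g -> f c = g c ->
  continuous (glue c f g).
Proof.
move=> cf cg fg x; case: (ltgtP x c) => [xc|xc|->].
- apply: cvg_trans; first exact: near_eq_cvg (glue_near_left f g xc).
  by rewrite /glue (ltW xc); exact: cf.
- apply: cvg_trans; first exact: near_eq_cvg (glue_near_right f g xc).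
  by rewrite /glue leNgt xc; exact: cg.
- rewrite /continuous_at [glue c f g c]/glue lexx.
  by apply: cvg_if; [exact: cf|rewrite fg; exact: cg].
Qed.

(** At the node the difference quotient of the glued function is, on either
    side, that of one of the two functions, and both tend to the same limit. *)
Lemma is_derive_glue (R : realType) (X : normedModType R) (c : R)
    (f g f' g' : R -> X) :
  (forall s : R, is_derive s 1 f (f' s)) -> (forall s : R, is_derive s 1 g (g' s)) ->
  f c = g c -> f' c = g' c ->
  forall s : R, is_derive s 1 (glue c f g) (glue c f' g' s).
Proof.
move=> df dg fg fg' s; case: (ltgtP s c) => [sc|sc|->].
- apply: near_eq_is_derive (glue_near_left f g sc) _.
  by rewrite /glue (ltW sc).
- apply: near_eq_is_derive (glue_near_right f g sc) _.
  by rewrite /glue leNgt sc.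
- apply/is_derive1P; rewrite /glue lexx.
  have -> : (fun y => (y - c)^-1 *: ((if y <= c then f y else g y) - f c)) =
     (fun y => if y <= c then (y - c)^-1 *: (f y - f c)
               else (y - c)^-1 *: (g y - g c)).
    by apply/funext => y; rewrite -fg; case: ifP.
  apply: cvg_if; first exact/is_derive1P.
  by rewrite fg'; exact/is_derive1P.
Qed.

(** One-sided quotients at the end points are covered by a function that is
    differentiable beyond them. *)
Lemma C1_on_of_is_derive (R : realType) (X : normedModType R) (a b : R)
    (f g g' : R -> X) :
  (forall s : R, is_derive s 1 g (g' s)) -> continuous g' ->
  {in `[a, b], f =1 g} -> C1_on a b f.
Proof.
move=> dg cg' fg; exists g'; first exact: continuous_subspaceT.
move=> x xab.
have /is_derive1P H := dg x.
apply: cvg_trans (cvg_trans (cvg_app _ (cvg_within _)) H).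
apply: near_eq_cvg; rewrite near_withinE; apply: nearW => y yab /=.
by rewrite !fg.
Qed.

(** * Vector-valued polynomials *)

(** Unlike the monomial form, where differentiation shifts the indices, this
    form is stable under it with the same vectors: only the [p k] change. *)
Definition poly_comb (R : realType) (X : normedModType R) (m : nat)
    (c : 'I_m -> X) (p : 'I_m -> {poly R}) : R -> X :=
  fun s => \sum_(k < m) (p k).[s] *: c k.

Lemma poly_in_time_poly_comb (R : realType) (X : normedModType R) (q : nat)
    (f : R -> X) : poly_in_time q f ->
  exists m (c : 'I_m -> X) p, f = poly_comb c p.
Proof.
move=> [c fE]; exists q.+1, c, (fun k => 'X^k); apply/funext => s.
by rewrite fE; apply: eq_bigr => k _; rewrite hornerXn.
Qed.

Section poly_comb_calculus.
Context (R : realType) (X : normedModType R) (m : nat) (c : 'I_m -> X).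
Implicit Types p : 'I_m -> {poly R}.

Lemma is_derive_poly_comb p (s : R) :
  is_derive s 1 (poly_comb c p) (poly_comb c (fun k => (p k)^`()) s).
Proof.
have -> : poly_comb c p = \sum_(k < m) (fun s => (p k).[s] *: c k).
  by apply/funext => y; rewrite fct_sumE.
apply: is_derive_sum => k; apply/is_derive1P.
have -> : (fun y => (y - s)^-1 *: ((p k).[y] *: c k - (p k).[s] *: c k)) =
    (fun y => ((y - s)^-1 *: ((p k).[y] - (p k).[s])) *: c k).
  by apply/funext => y; rewrite -scalerBl scalerA.
by apply: cvgZr_tmp; apply/is_derive1P.
Qed.

Lemma derive1_poly_comb p : derive1 (poly_comb c p) = poly_comb c (fun k => (p k)^`()).
Proof.
by apply/funext => s; rewrite derive1E; case: (is_derive_poly_comb p s).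
Qed.

Lemma continuous_poly_comb p : continuous (poly_comb c p).
Proof.
move=> s; apply: differentiable_continuous; apply/derivable1_diffP.
by case: (is_derive_poly_comb p s).
Qed.

End poly_comb_calculus.

Lemma dot_poly_comb (R : realType) (X : normedModType R)
    (dot : {dot X for (@idfun R)}) m (c : 'I_m -> X) p s x :
  dot (poly_comb c p s) x = (\sum_(k < m) dot (c k) x *: p k).[s].
Proof.
rewrite /poly_comb linear_sumlz horner_sum; apply: eq_bigr => k _.
by rewrite linearZl_LR /= hornerZ mulrC.
Qed.

(** * Inner products with affine test functions *)

Lemma Rintegral_deriv_poly (R : realType) (a b : R) (F : {poly R}) : a < b ->
  (\int[lebesgue_measure]_(s in `]a, b]%classic) F^`().[s])%R = F.[b] - F.[a].
Proof.
move=> ab.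
have cF (p : {poly R}) : continuous (horner p) by exact: continuous_horner.
have cw : {within `[a, b], continuous (horner F^`())}.
  by apply: continuous_subspaceT; exact: cF.
rewrite Rintegral_itv_obnd_cbnd; last first.
  have iF : lebesgue_measure.-integrable `[a, b] (EFin \o horner F^`()).
    by apply: continuous_compact_integrable => //; exact: segment_compact.
  by apply: integrableS iF => //; apply: subset_itvr; rewrite bnd_simp.
rewrite /Rintegral (@continuous_FTC2 _ _ (horner F)) //.
- split.
  + by move=> x _; exact: derivable_horner.
  + by apply: cvg_at_right_filter; exact: cF.
  + by apply: cvg_at_left_filter; exact: cF.
- by move=> x _; rewrite derivE.
Qed.

Lemma dot_eq0 (R : realType) (X : completeNormedModType R)
    (dot : {dot X for (@idfun R)}) (hX : hilbert_norm dot) (u : X) :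
  (forall x, dot u x = 0) -> u = 0.
Proof.
by move=> /(_ u); rewrite hX => /eqP; rewrite sqrf_eq0 normr_eq0 => /eqP.
Qed.

Lemma poly_in_time_scale (R : realType) (X : normedModType R) (q : nat)
    (g : {poly R}) (x : X) : (size g <= q.+1)%N ->
  poly_in_time q (fun s => g.[s] *: x).
Proof.
move=> gq; exists (fun k => g`_k *: x) => s.
rewrite (horner_coef_wide s gq) scaler_suml.
by apply: eq_bigr => k _; rewrite scalerA mulrC.
Qed.

(** Integration by parts twice: for $\varphi(s) = (f(s), x)$ and $g'' = 0$,
    $g\varphi'' = (g\varphi' - g'\varphi)'$. *)
Lemma L2_inner_derive2 (R : realType) (X : completeNormedModType R)
    (dot : {dot X for (@idfun R)}) m (c : 'I_m -> X) p (a b : R)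
    (g : {poly R}) (x : X) : a < b -> g^`()^`() = 0 ->
  let F s := g.[s] * dot (derive1 (poly_comb c p) s) x
             - g^`().[s] * dot (poly_comb c p s) x in
  L2_inner dot `]a, b]%classic (derive1n 2 (poly_comb c p)) (fun s => g.[s] *: x) =
  F b - F a.
Proof.
move=> ab g2 F.
pose phi := \sum_(k < m) dot (c k) x *: p k.
have phi1 : \sum_(k < m) dot (c k) x *: (p k)^`() = phi^`().
  by rewrite /phi raddf_sum /=; apply: eq_bigr => k _; rewrite derivZ.
have phi2 : \sum_(k < m) dot (c k) x *: (p k)^`()^`() = phi^`()^`().
  by rewrite -phi1 raddf_sum /=; apply: eq_bigr => k _; rewrite derivZ.
have FE s : F s = (g * phi^`() - g^`() * phi).[s].
  by rewrite /F derive1_poly_comb !dot_poly_comb phi1 !hornerE.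
rewrite !FE -Rintegral_deriv_poly // /L2_inner.
apply: eq_Rintegral => s _.
rewrite /= !derive1_poly_comb linearZr_LR /= dot_poly_comb phi2.
rewrite derivB !derivM g2 mul0r add0r !hornerE; ring.
Qed.

(** The boundary terms at [a] cancel against the jump term, so testing with an
    affine $h$ times $x$ leaves $h(b) (D'(b), x) = h'(b) (D(b), x)$ for
    $D = f - g$.  Taking $h = 1$ gives $D'(b) = 0$, after which $h(s) = s$ gives
    $D(b) = 0$. *)
Lemma reconstruction_cell (R : realType) (X : completeNormedModType R)
    (dot : {dot X for (@idfun R)}) (hX : hilbert_norm dot)
    (a b : R) (ab : a < b) (d q : nat) (r : nat) (f g : R -> X) (j : X) :
  (0 < d)%N -> poly_in_time q f -> poly_in_time r g ->
  (forall h, poly_in_time d h ->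
     L2_inner dot `]a, b]%classic (derive1n 2 f) h =
     L2_inner dot `]a, b]%classic (derive1n 2 g) h + dot j (h a)) ->
  f a = g a -> derive1 g a - derive1 f a = j ->
  f b = g b /\ derive1 f b = derive1 g b.
Proof.
move=> d0 /poly_in_time_poly_comb[m [c [p ->]]] /poly_in_time_poly_comb[n [e [u ->]]].
set f' := poly_comb c p; set g' := poly_comb e u => H fga jE.
have test (h : {poly R}) x : (size h <= 2)%N ->
    h.[b] * dot (derive1 f' b - derive1 g' b) x =
    h^`().[b] * dot (f' b - g' b) x.
  move=> h2.
  have hd : h^`()^`() = 0 := derivn_poly0 h2.
  have := H _ (@poly_in_time_scale _ _ d h x (leq_trans h2 (d0 : (2 <= d.+1)%N))).
  rewrite !L2_inner_derive2 // -/f' -/g' -jE fga.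
  rewrite linearZr_LR /= !linearBl /=.
  lra.
have D1 : derive1 f' b = derive1 g' b.
  apply/eqP; rewrite -subr_eq0; apply/eqP/(dot_eq0 hX) => x.
  have := test 1 x; rewrite size_poly1 => /(_ isT).
  by rewrite derivC !hornerE.
split=> //.
apply/eqP; rewrite -subr_eq0; apply/eqP/(dot_eq0 hX) => x.
have := test 'X x; rewrite size_polyX => /(_ isT).
by rewrite D1 subrr linear0l derivX !hornerE.
Qed.

(** * The reconstruction on the whole grid *)

Lemma time_grid_le (R : realType) (N : nat) (T : R) (t : nat -> R) :
  time_grid N T t -> forall i j, (i <= j <= N)%N -> t i <= t j.
Proof.
move=> [_ _ tS] i; elim=> [|j IH] /andP[ij jN].
  by move: ij; rewrite leqn0 => /eqP->.
move: ij; rewrite leq_eqVlt => /predU1P[->//|ij].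
by apply: le_trans (ltW (tS _ jN)); rewrite IH // -ltnS ij ltnW.
Qed.

(** The cell is open at its left end, so the value there is reached only as the
    limit from the right. *)
Lemma eq_left_end (R : realType) (X : normedModType R) (a b : R) (f g : R -> X) :
  a < b -> {within `[a, b], continuous f} -> continuous g ->
  {in `]a, b]%classic, f =1 g} -> f a = g a.
Proof.
move=> ab /continuous_within_itvP-/(_ ab)[_ fa _] cg fg.
have ga : g x @[x --> a^'+] --> g a by apply: cvg_at_right_filter; exact: cg.
have fga : f x @[x --> a^'+] --> g a.
  apply: cvg_trans ga; apply: near_eq_cvg; near=> x.
  rewrite fg // inE /= in_itv /=; apply/andP; split; near: x.
  - exact: nbhs_right_gt.
  - exact: nbhs_right_le.
exact: cvg_unique fa fga.
Unshelve. all: by end_near. Qed.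

Lemma poly_in_time_is_derive (R : realType) (X : normedModType R) (q : nat)
    (f : R -> X) : poly_in_time q f ->
  (forall s : R, is_derive s 1 f (derive1 f s)) /\ continuous (derive1 f).
Proof.
move=> /poly_in_time_poly_comb[m [c [p ->]]]; rewrite derive1_poly_comb; split.
  by move=> s; exact: is_derive_poly_comb.
exact: continuous_poly_comb.
Qed.

Lemma poly_in_time_continuous (R : realType) (X : normedModType R) (q : nat)
    (f : R -> X) : poly_in_time q f -> continuous f.
Proof. by move=> /poly_in_time_poly_comb[m [c [p ->]]]; exact: continuous_poly_comb. Qed.

Unset Implicit Arguments.

Theorem proposition3p2 (R : realType) (X : completeNormedModType R)
    (dot : {dot X for (@idfun R)}) (hX : hilbert_norm dot)
    (N : nat) (hN : (0 < N)%N) (T : R) (t : nat -> R) (ht : time_grid N T t)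
    (p : nat -> nat) (hp : forall n, (1 <= n <= N)%N -> (2 <= p n)%N)
    (v0 : X) (V : R -> X) (P : nat -> R -> X)
    (hVcont : {within `[0, T], continuous V})
    (hV : piecewise_poly N t p V P)
    (Vh : R -> X) (Q : nat -> R -> X)
    (hVh : reconstruction dot N t p v0 V P Vh Q) :
  C1_on 0 T Vh.
Proof.
have [t0 tN tS] := ht.
have [hQ Vh0 hrec] := hVh.
have match_left n : (n < N)%N -> V (t n) = P n.+1 (t n).
  move=> nN; have [Pn VP] := hV n.+1 nN.
  apply: (eq_left_end (tS n nN)) VP; last exact: poly_in_time_continuous Pn.
  apply: continuous_subspaceW hVcont; apply: subset_itv; rewrite bnd_simp.
  - by rewrite -t0; apply: (time_grid_le ht); rewrite leq0n ltnW.
  - by rewrite -tN; apply: (time_grid_le ht); rewrite nN leqnn.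
have match_right n : (n < N)%N -> Q n.+1 (t n.+1) = V (t n.+1) /\
    derive1 (Q n.+1) (t n.+1) = derive1 (P n.+1) (t n.+1).
  move=> nN; have [Pn VP] := hV n.+1 nN; have [Qn _] := hQ n.+1 nN.
  have [orth Qa dQa] := hrec n.+1 nN.
  have tc : t n.+1 \in cell t n.+1.
    by rewrite inE /cell /= in_itv /= lexx tS.
  rewrite (VP _ tc).
  have d0 : (0 < (p n.+1).-1)%N by have := hp n.+1 nN; case: (p n.+1) => [|[]].
  apply: (reconstruction_cell hX (tS n nN) d0 Qn Pn orth).
  - by rewrite Qa match_left.
  - by rewrite dQa.
(* The conditions at the right end are carried along because they are the
   initial conditions of the next piece. *)
have glued n : (n < N)%N -> exists G G' : R -> X,
    [/\ forall s : R, is_derive s 1 G (G' s), continuous G',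
        {in `[0, t n.+1], Vh =1 G}, G (t n.+1) = V (t n.+1) &
        G' (t n.+1) = derive1 (P n.+1) (t n.+1)].
  elim: n => [|n IH] nN; have [Qr dQr] := match_right _ nN.
    have [Qn VQ] := hQ 1%N nN; have [dQ cQ] := poly_in_time_is_derive Qn.
    exists (Q 1%N), (derive1 (Q 1%N)); split=> // s; rewrite in_itv /= => /andP[s0 s1].
    move: s0; rewrite le_eqVlt => /predU1P[<-|s0]; first by rewrite -t0.
    by apply: VQ; rewrite inE /cell /= in_itv /= t0 s0.
  have [G [G' [dG cG' VG Gt G't]]] := IH (ltnW nN).
  have [Qn VQ] := hQ n.+2 nN; have [dQ cQ] := poly_in_time_is_derive Qn.
  have [_ Qa dQa] := hrec n.+2 nN.
  have GQ : G (t n.+1) = Q n.+2 (t n.+1) by rewrite Gt Qa.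
  have dGQ : G' (t n.+1) = derive1 (Q n.+2) (t n.+1) by rewrite G't dQa.
  exists (glue (t n.+1) G (Q n.+2)), (glue (t n.+1) G' (derive1 (Q n.+2))).
  split.
  - exact: is_derive_glue.
  - exact: continuous_glue.
  - move=> s; rewrite in_itv /= => /andP[s0 s1]; rewrite /glue; case: leP => st.
      by apply: VG; rewrite in_itv /= s0.
    by apply: VQ; rewrite inE /cell /= in_itv /= st.
  - by rewrite /glue leNgt tS.
  - by rewrite /glue leNgt tS.
have NE : N = N.-1.+1 by rewrite prednK.
have [|G [G' [dG cG' VG _ _]]] := glued N.-1; first by rewrite -NE.
by apply: C1_on_of_is_derive dG cG' _; rewrite -tN {1}NE.
Qed.
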